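(* Let $d$ be a positive integer, $\Omega=\mathbb{R}^d$, $\Theta\subseteq\mathbb{R}^d$, and let $\Pi$ have density $\pi$ with respect to Lebesgue measure on $\mathbb{R}^d$ with $\sup_{\theta\in\Theta}\pi(\theta)<\infty$. Let $c(\cdot,\cdot)$ be a metric cost function on $\mathbb{R}^d$ such that, for some positive constant $C_{0,d}$, $c(\theta,\omega)\ge C_{0,d}\|\theta-\omega\|_1$ for all $\theta,\omega\in\mathbb{R}^d$. Let $P$ be an ARB Markov kernel with invariant measure $\Pi$ and acceptance probability $A(\cdot)$, and let $p$ be a positive integer. If $P$ is $(c,p,\rho,M)$-geometrically ergodic, then $$\rho^{\frac{d}{d+1}}\ \ge\ 1-\inf_{\theta\in\Theta}A(\theta).$$
   Context: $\Pi$ is a probability measure on $(\Omega,\mathcal{B}(\Omega))$, $\Omega=\mathbb{R}^d$, supported on a nonempty measurable set $\Theta\subseteq\mathbb{R}^d$; the support of $\pi$ is $\Theta$, so $\pi(\theta)>0$ for each $\theta\in\Theta$. Write $\lambda$ for Lebesgue measure. ARB kernel: for each $\theta\in\Omega$, $Q(\theta,\cdot)$ is a proposal distribution on $(\Omega,\mathcal{B}(\Omega))$ with density $q(\theta,\cdot)$ with respect to $\lambda$. Given an acceptance function $a:\Omega\times\Omega\to[0,1]$, the acceptance probability is $A(\theta)=\int a(\theta,\theta')q(\theta,\theta')\,d\lambda(\theta')$, and the ARB Markov kernel is $$P(\theta,B)=\int_B a(\theta,\theta')q(\theta,\theta')\,d\lambda(\theta')+\delta_\theta(B)[1-A(\theta)],\qquad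 \theta\in\Omega,\ B\in\mathcal{B}(\Omega),$$ where $\delta_\theta$ is the Dirac measure at $\theta$. It is assumed that $a$ is such that $\Pi$ is invariant for $P$ (reversibility is not assumed). $P^t$ denotes the $t$-step kernel, $P^1=P$. Wasserstein distance of order $p$: for probability measures $\mu,\nu$, $\mathcal{W}_c^p(\mu,\nu)=\left(\inf_{\Gamma\in\mathcal{C}(\mu,\nu)}\int c(\theta,\omega)^p\,d\Gamma(\theta,\omega)\right)^{1/p}\in[0,\infty]$, where $\mathcal{C}(\mu,\nu)$ is the set of joint probability measures with marginals $\mu,\nu$ (the superscript $p$ denotes the order, not a power; $c$ is such that the integrals are defined). $\|\cdot\|_1$ is the 1-norm on $\mathbb{R}^d$. $P$ is $(c,p,\rho,M)$-geometrically ergodic if $\rho\in(0,1)$ and $M:\Theta\to(0,\infty)$ are such that $\mathcal{W}_c^p(P^t(\theta,\cdot),\Pi)\le M(\theta)\rho^t$ for every $\theta\in\Theta$ and every positive integer $t$. *)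

(* Defs.v *)
From HB Require Import structures.
From mathcomp Require Import all_boot all_order all_algebra.
From mathcomp Require Import all_classical all_reals all_analysis.

Set Implicit Arguments.
Unset Strict Implicit.
Unset Printing Implicit Defensive.
Import Order.TTheory GRing.Theory Num.Theory.

Local Open Scope classical_set_scope.
Local Open Scope ring_scope.
Local Open Scope ereal_scope.

(* R^n is [n.-tuple R]: its library sigma-algebra, generated by the coordinate
   maps, is the Borel sigma-algebra of R^n. *)

Section lebesgue_step.
Context {R : realType} (n : nat).
Variable mu : {sigma_finite_measure set (n.-tuple R) -> \bar R}.

(* [lebesgue_measure] lives on [measurableTypeR R], which is convertible to R
   (same sigma-algebra) but carries a different display. *)
Definition tcons (z : measurableTypeR R * n.-tuple R) : n.+1.-tuple R :=
  [the n.+1.-tuple R of z.1 :: z.2].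

Lemma measurable_tcons : measurable_fun [set: measurableTypeR R * n.-tuple R] tcons.
Proof. exact: (measurable_cons measurable_fst measurable_snd). Qed.

Let prodm : {measure set (measurableTypeR R * n.-tuple R)%type -> \bar R} :=
  @lebesgue_measure R \x mu.

Lemma behead_tcons z : [tuple of behead (tcons z)] = z.2.
Proof. exact/val_inj. Qed.

Definition lebesgue_step : set (n.+1.-tuple R) -> \bar R :=
  pushforward prodm tcons.

Let step0 : lebesgue_step set0 = 0.
Proof. by rewrite /lebesgue_step /pushforward preimage_set0; exact: (measure0 prodm). Qed.

Let step_ge0 A : 0 <= lebesgue_step A.
Proof. exact: (measure_ge0 prodm). Qed.

Let preim A : measurable A -> measurable (tcons @^-1` A).
Proof. by move=> mA; rewrite -[X in measurable X]setTI; exact: measurable_tcons. Qed.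

Let step_sigma_additive : semi_sigma_additive lebesgue_step.
Proof.
move=> F mF tF mUF; rewrite /lebesgue_step /pushforward preimage_bigcup.
apply: (@measure_semi_sigma_additive _ _ _ prodm).
- by move=> k; exact: preim.
- apply/trivIsetP => /= i j _ _ ij; rewrite -preimage_setI.
  by move/trivIsetP : tF => /(_ _ _ _ _ ij) ->//; rewrite preimage_set0.
- by rewrite -preimage_bigcup; exact: preim.
Qed.

HB.instance Definition _ := isMeasure.Build _ _ _ lebesgue_step
  step0 step_ge0 step_sigma_additive.

Lemma lebesgue_stepX (A : set (measurableTypeR R)) (B : set (n.-tuple R)) :
  measurable A -> measurable B ->
  lebesgue_step [set t | A (thead t) /\ B [tuple of behead t]] =
  lebesgue_measure A * mu B.
Proof.
move=> mA mB; rewrite -(product_measure1E (@lebesgue_measure R) mu)//.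
rewrite /lebesgue_step /pushforward/=; congr (_ \x _).
by apply/seteqP; split => z; rewrite /preimage /= behead_tcons theadE.
Qed.

Let step_sigma_finite : sigma_finite setT lebesgue_step.
Proof.
have /sigma_finiteP[F [TF ndF Foo]] := sigma_finiteT (@lebesgue_measure R).
have /sigma_finiteP[G [TG ndG Goo]] := sigma_finiteT mu.
exists (fun k => [set t | F k (thead t) /\ G k [tuple of behead t]]).
  apply/seteqP; split => // t _.
  have [i _ Fi] : (\bigcup_k F k) (thead t) by rewrite -TF.
  have [j _ Gj] : (\bigcup_k G k) [tuple of behead t] by rewrite -TG.
  exists (maxn i j) => //; split.
  - by move: Fi; exact/subsetPset/ndF/leq_maxl.
  - by move: Gj; exact/subsetPset/ndG/leq_maxr.
move=> k; have [mF Fk] := Foo k; have [mG Gk] := Goo k; split.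
  apply: measurableI; rewrite -[X in measurable X]setTI.
    exact: (@measurable_tnth _ R n.+1 ord0).
  exact: measurable_behead.
by rewrite lebesgue_stepX// lte_mul_pinfty// ge0_fin_numE.
Qed.

HB.instance Definition _ := @Measure_isSigmaFinite.Build _ _ _ lebesgue_step
  step_sigma_finite.

End lebesgue_step.

Fixpoint lebesgue_tuple {R : realType} (n : nat) :
    {sigma_finite_measure set (n.-tuple R) -> \bar R} :=
  match n with
  | 0 => \d_([tuple] : 0.-tuple R)
  | m.+1 => lebesgue_step (lebesgue_tuple m)
  end.

Lemma lebesgue_tuple_box {R : realType} n (A : 'I_n -> set R) :
  (forall i, measurable (A i)) ->
  lebesgue_tuple n [set t | forall i, A i (tnth t i)] =
  \prod_(i < n) lebesgue_measure (A i).
Proof.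
elim: n A => [|n IH] A mA.
  by rewrite big_ord0 /= diracE mem_set// => -[].
have mB : measurable [set t : n.-tuple R | forall i, A (lift ord0 i) (tnth t i)].
  rewrite (_ : mkset _ = \bigcap_(i in [set: 'I_n])
      [set t : n.-tuple R | A (lift ord0 i) (tnth t i)]); last first.
    by apply/seteqP; split => t /= h i; [move=> _; exact: h|exact: h i I].
  apply: fin_bigcap_measurable => // i _; rewrite -[X in measurable X]setTI.
  exact: (@measurable_tnth _ R n i).
have iE (i : 'I_n) : inord i.+1 = lift ord0 i :> 'I_n.+1.
  by apply/val_inj; rewrite /= inordK// ltnS.
rewrite big_ord_recl -IH; last by move=> i; exact: mA.
rewrite -[LHS]/(lebesgue_step _ _) -lebesgue_stepX; [|exact: mA|exact: mB].
congr (lebesgue_step _ _); apply/seteqP; split => t /=.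
  by move=> h; split => [|i]; [exact: h|rewrite tnth_behead iE; exact: h].
move=> [h0 h] i; case: (unliftP ord0 i) => [j|] -> //.
by have := h j; rewrite tnth_behead iE.
Qed.

Section markov.
Context {d} {T : measurableType d} {R : realType}.

Section comp.
Variables k1 k2 : R.-pker T ~> T.
Let prob x : mkcomp_noparam k1 k2 x setT = 1.
Proof.
rewrite -[LHS]/(\int[k1 x]_y k2 y setT).
under eq_integral do rewrite prob_kernel.
by rewrite integral_cst// mul1e prob_kernel.
Qed.
HB.instance Definition _ :=
  isProbabilityKernel.Build _ _ _ _ _ (mkcomp_noparam k1 k2) prob.
End comp.

Fixpoint kernel_pow (P : R.-pker T ~> T) (t : nat) : R.-pker T ~> T :=
  match t with
  | 0 => kdirac (@measurable_id _ T setT)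
  | s.+1 => mkcomp_noparam (kernel_pow P s) P
  end.

Lemma kernel_pow1 P x B : measurable B -> kernel_pow P 1 x B = P x B.
Proof.
move=> mB; rewrite -[LHS]/(\int[\d_x]_y P y B).
rewrite integral_dirac//; last exact: measurable_kernel.
by rewrite diracT mul1e.
Qed.

Definition invariant_measure (P : R.-pker T ~> T) (Pi : probability T R) : Prop :=
  forall B, measurable B -> \int[Pi]_x P x B = Pi B.

Definition has_density (lam : {measure set T -> \bar R}) (mu : probability T R)
    (f : T -> R) : Prop :=
  [/\ measurable_fun setT f, forall x, (0 <= f x)%R &
      forall B, measurable B -> mu B = \int[lam]_(y in B) (f y)%:E].

Definition acceptance_prob (lam : {measure set T -> \bar R})
    (q a : T -> T -> R) (x : T) : \bar R :=
  \int[lam]_y (a x y * q x y)%:E.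

(* No joint measurability of [a] and [q] is asked for: the measurability of
   x |-> P x B is carried by the type of [P]. *)
Record arb_kernel (lam : {measure set T -> \bar R}) (Q : T -> probability T R)
    (q a : T -> T -> R) (P : R.-pker T ~> T) : Prop := {
  arb_proposal : forall x, has_density lam (Q x) (q x) ;
  arb_measurable_acceptance : forall x, measurable_fun setT (a x) ;
  arb_acceptance01 : forall x y, (0 <= a x y <= 1)%R ;
  arb_kernelE : forall x B, measurable B ->
    P x B = \int[lam]_(y in B) (a x y * q x y)%:E
            + \d_x B * (1 - acceptance_prob lam q a x) }.

Definition metric_cost (c : T -> T -> R) : Prop :=
  [/\ forall x y, (0 <= c x y)%R, forall x y, c x y = 0%R <-> x = y,
      forall x y, c x y = c y x &
      forall x y z, (c x z <= c x y + c y z)%R].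

Definition coupling (mu nu : {measure set T -> \bar R})
    (G : probability (T * T)%type R) : Prop :=
  (forall B, measurable B -> G (B `*` setT) = mu B) /\
  (forall B, measurable B -> G (setT `*` B) = nu B).

(* [p] is the order of the distance, valued in [0, +oo]; the library power
   satisfies +oo `^ r = +oo for r != 0. *)
Definition wasserstein (c : T -> T -> R) (p : nat)
    (mu nu : {measure set T -> \bar R}) : \bar R :=
  (ereal_inf [set \int[G]_z (c z.1 z.2 ^+ p)%:E | G in coupling mu nu])
    `^ (p%:R^-1).

Definition geometrically_ergodic (c : T -> T -> R) (p : nat) (rho : R)
    (M : T -> R) (Theta : set T) (P : R.-pker T ~> T) (Pi : probability T R)
    : Prop :=
  [/\ (0 < rho < 1)%R, forall x, Theta x -> (0 < M x)%R &
      forall x, Theta x -> forall t : nat, (0 < t)%N ->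
        wasserstein c p (kernel_pow P t x) Pi <= (M x * rho ^+ t)%:E].

End markov.

Definition dist1 {R : realType} (d : nat) (x y : d.-tuple R) : R :=
  (\sum_(i < d) `|tnth x i - tnth y i|)%R.

(* Main.v *)
Require Import Defs.
From HB Require Import structures.
From mathcomp Require Import all_boot all_order all_algebra.
From mathcomp Require Import all_classical all_reals all_analysis.
From mathcomp Require Import measurable_realfun ring lra.
Import Order.TTheory GRing.Theory Num.Theory.
Local Open Scope classical_set_scope.
Local Open Scope ring_scope.
Local Open Scope ereal_scope.

(** A rejected proposal leaves the chain where it is, so a chain started at
x still sits exactly at x after t steps with probability at least r^t, where
r = 1 - A(x) ([kernel_pow_atom_ge], [arb_kernel_atom_ge]).  The target has a
bounded density and therefore gives a small cube around x a mass at most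
proportional to the volume of that cube ([has_density_le],
[lebesgue_tuple_cube]).  When the cube has side of order r^(t/d), its target
mass is at most r^t / 2, and every coupling of P^t(x, .) with the target has to
carry a mass at least r^t / 2 from the atom at x out of the cube, over a distance
of order r^(t/d).  As the cost dominates a multiple of the 1-norm, this bounds the Wasserstein
distance from below ([wasserstein_ge]) by a constant times

  r^(t/d) * r^t = (r^(1/d) * r)^t.

Geometric ergodicity bounds the same distance by M(x) rho^t for every t > 0.
Comparing exponential rates ([le_base_of_geometric_le]) yields
r^(1/d) * r <= rho, that is r <= rho^(d/(d+1)), for each x in Theta; the
statement follows on taking the infimum of A over Theta.

For a cost of order p, moving a mass m over a distance delta contributes
delta * m^(1/p) to the distance, which is at least delta * m because m <= 1: the
resulting bound is the one for p = 1, whatever the order. *)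

(** * Kernels with rejection *)

Lemma integral_ge_cst_measure {disp : measure_display} {T : measurableType disp}
    {R : realType} (mu : {measure set T -> \bar R}) (D : set T) (f : T -> \bar R)
    (l : \bar R) :
  measurable D -> measurable_fun setT f -> (forall x, 0 <= f x) -> 0 <= l ->
  (forall x, D x -> l <= f x) -> l * mu D <= \int[mu]_x f x.
Proof.
move=> mD mf f0 l0 lf; rewrite -integral_cst//.
apply: (@le_trans _ _ (\int[mu]_(x in D) f x)).
  by apply: ge0_le_integral => //; exact: measurable_funTS.
exact: ge0_subset_integral.
Qed.

(** Staying at x at each of the t steps is one way to be at x at time t: the
integral over the position at time t is restricted to the atom x. *)
Lemma kernel_pow_atom_ge {disp : measure_display} {T : measurableType disp}
    {R : realType} (P : R.-pker T ~> T) (x : T) (r : R) (t : nat) :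
  measurable [set x] -> (0 <= r)%R -> r%:E <= P x [set x] ->
  (r ^+ t)%:E <= kernel_pow P t x [set x].
Proof.
move=> mx r0 rP; elim: t => [|t IH]; first by rewrite /= diracE mem_set.
rewrite -[leRHS]/(\int[kernel_pow P t x]_y P y [set x]).
apply: (@le_trans _ _ (r%:E * kernel_pow P t x [set x])).
  by rewrite exprS EFinM lee_wpmul2l// lee_fin.
apply: integral_ge_cst_measure => //; first exact: measurable_kernel.
by move=> _ ->.
Qed.

(** The inequality may be strict: for a general reference measure, the absolutely
continuous part of the kernel may also charge x. *)
Lemma arb_kernel_atom_ge {disp : measure_display} {T : measurableType disp}
    {R : realType} (lam : {measure set T -> \bar R}) (Q : T -> probability T R)
    (q a : T -> T -> R) (P : R.-pker T ~> T) (x : T) :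
  arb_kernel lam Q q a P -> measurable [set x] ->
  1 - acceptance_prob lam q a x <= P x [set x].
Proof.
move=> [Pq _ a01 PE] mx; rewrite PE// diracE mem_set// mul1e leeDr//.
have [_ q0 _] := Pq x; apply: integral_ge0 => y _; rewrite lee_fin mulr_ge0//.
by have /andP[] := a01 x y.
Qed.

Lemma acceptance_prob_ge0_le1 {disp : measure_display} {T : measurableType disp}
    {R : realType} (lam : {measure set T -> \bar R}) (Q : T -> probability T R)
    (q a : T -> T -> R) (P : R.-pker T ~> T) (x : T) :
  arb_kernel lam Q q a P -> 0 <= acceptance_prob lam q a x <= 1.
Proof.
move=> [Pq ma a01 _]; have [mq q0 qQ] := Pq x.
have aq0 y : 0 <= (a x y * q x y)%:E.
  by rewrite lee_fin mulr_ge0//; have /andP[] := a01 x y.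
rewrite integral_ge0//= -(probability_setT (Q x)) qQ//.
apply: ge0_le_integral => //.
- exact/measurable_EFinP/measurable_funM.
- exact/measurable_EFinP.
- by move=> y _; rewrite lee_fin ler_piMl//; have /andP[] := a01 x y.
Qed.

(** * A lower bound on the Wasserstein distance *)

(** Of the mass that mu puts on D, at most nu B can be
sent to B, so any coupling moves at least m from D to the complement of B, at
cost delta or more.  This gives delta * m^(1/p), and m <= m^(1/p) since m <= 1:
the weaker bound delta * m does not depend on p. *)
Lemma wasserstein_ge {disp : measure_display} {T : measurableType disp}
    {R : realType} (mu nu : {measure set T -> \bar R}) (c : T -> T -> R)
    (p : nat) (D B : set T) (delta m : R) :
  measurable_fun setT (fun z : (T * T)%type => c z.1 z.2) ->
  (forall x y, (0 <= c x y)%R) -> (0 < p)%N ->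
  measurable D -> measurable B -> (0 <= delta)%R -> (0 <= m <= 1)%R ->
  m%:E + nu B <= mu D ->
  (forall x y, D x -> ~ B y -> (delta <= c x y)%R) ->
  (delta * m)%:E <= wasserstein c p mu nu.
Proof.
move=> mc c0 p0 mD mB d0 /andP[m0 m1] mDB dc.
have dmp0 : (0 <= delta * m)%R by rewrite mulr_ge0.
have p_neq0 : p%:R != 0%R :> R by rewrite pnatr_eq0 -lt0n.
rewrite (_ : (delta * m)%:E = ((delta * m) ^+ p)%:E `^ p%:R^-1); last first.
  by rewrite poweR_EFin -powR_mulrn// -powRrM divff// powRr1.
suff inf_ge : ((delta * m) ^+ p)%:E <=
    ereal_inf [set \int[G]_z (c z.1 z.2 ^+ p)%:E | G in coupling mu nu].
  apply: gt0_ler_poweR => //.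
    by rewrite in_itv /= leey andbT lee_fin exprn_ge0.
  rewrite in_itv /= leey andbT; apply: le_trans inf_ge.
  by rewrite lee_fin exprn_ge0.
apply: le_ereal_inf_tmp => _ [G [Gmu Gnu] <-].
(* D x setT is covered by D x ~B and setT x B, of masses at most
   G (D x ~B) and nu B. *)
have mG : m%:E <= G (D `*` ~` B).
  have GB : nu B \is a fin_num.
    by rewrite -Gnu//; apply: fin_num_measure; exact: measurableX.
  rewrite -(leeD2rE _ _ GB); apply: (le_trans mDB).
  rewrite -Gmu// -Gnu//.
  have := @measureU2 _ _ _ G (D `*` ~` B) (setT `*` B)
    (measurableX mD (measurableC mB)) (measurableX measurableT mB).
  apply: le_trans; apply: le_measure; rewrite ?inE.
  - exact: measurableX.
  - by apply: measurableU; apply: measurableX => //; exact: measurableC.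
  - move=> [x y] [/= Dx _]; have [By|nBy] := pselect (B y); [right|left] => //.
apply: (@le_trans _ _ ((delta ^+ p)%:E * G (D `*` ~` B))).
  apply: (@le_trans _ _ ((delta ^+ p)%:E * m%:E)).
    rewrite -EFinM lee_fin exprMn ler_wpM2l ?exprn_ge0//.
    by rewrite -(prednK p0) exprS ler_piMr// exprn_ile1.
  by rewrite lee_wpmul2l// lee_fin exprn_ge0.
apply: integral_ge_cst_measure.
- by apply: measurableX => //; exact: measurableC.
- apply/measurable_EFinP.
  exact: measurable_funX.
- by move=> z; rewrite lee_fin exprn_ge0.
- by rewrite lee_fin exprn_ge0.
- by move=> [x y] [/= Dx nBy]; rewrite lee_fin lerXn2r// ?nnegrE// dc.
Qed.

(** * Cubes and bounded densities *)

Lemma measurable_tuple_box {R : realType} {n : nat} (A : 'I_n -> set R) :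
  (forall i, measurable (A i)) ->
  measurable [set t : n.-tuple R | forall i, A i (tnth t i)].
Proof.
move=> mA; rewrite (_ : mkset _ = \bigcap_(i in [set: 'I_n])
    [set t : n.-tuple R | A i (tnth t i)]); last first.
  by apply/seteqP; split => t /= h i; [move=> _; exact: h|exact: h i I].
apply: fin_bigcap_measurable => // i _; rewrite -[X in measurable X]setTI.
exact: (@measurable_tnth _ R n i).
Qed.

Lemma measurable_tuple_set1 {R : realType} {n : nat} (x : n.-tuple R) :
  measurable [set x].
Proof.
rewrite (_ : [set x] = [set t | forall i, [set tnth x i] (tnth t i)]).
  by apply: (measurable_tuple_box (fun i => [set tnth x i])).
by apply/seteqP; split => [t -> //|t /= h]; exact/eq_from_tnth.
Qed.

Definition cube {R : realType} {n : nat} (x : n.-tuple R) (h : R) :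
  set (n.-tuple R) :=
  [set t | forall i, `]tnth x i - h, tnth x i + h[%classic%R (tnth t i)].

Lemma measurable_cube {R : realType} {n : nat} (x : n.-tuple R) (h : R) :
  measurable (cube x h).
Proof.
by apply: (measurable_tuple_box (fun i => `]tnth x i - h, tnth x i + h[%classic%R)).
Qed.

Lemma lebesgue_tuple_cube {R : realType} {n : nat} (x : n.-tuple R) (h : R) :
  (0 < h)%R -> lebesgue_tuple n (cube x h) = ((2 * h) ^+ n)%:E.
Proof.
move=> h0.
rewrite /cube (@lebesgue_tuple_box _ _
  (fun i => `]tnth x i - h, tnth x i + h[%classic%R))//.
rewrite (eq_bigr (fun=> (2 * h)%R%:E)); last first.
  move=> i _; rewrite lebesgue_measure_itv /= lte_fin.
  by rewrite ifT; [rewrite -EFinB; congr EFin; lra|lra].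
by rewrite prodEFin prodr_const card_ord.
Qed.

(** A point outside the cube is at distance at least h already in one
coordinate, and the 1-norm dominates each coordinate. *)
Lemma dist1_ge_notin_cube {R : realType} {n : nat} (x y : n.-tuple R) (h : R) :
  ~ cube x h y -> (h <= dist1 x y)%R.
Proof.
move=> /existsNP[i]; rewrite /= in_itv /= -ltr_distlC => /negP; rewrite -leNgt.
move=> /le_trans; apply; rewrite /dist1 (bigD1 i)//= lerDl.
exact: sumr_ge0.
Qed.

Lemma has_density_le {disp : measure_display} {T : measurableType disp}
    {R : realType} (lam : {measure set T -> \bar R}) (mu : probability T R)
    (f : T -> R) (S : R) (B : set T) :
  has_density lam mu f -> (forall x, (f x <= S)%R) -> measurable B ->
  mu B <= S%:E * lam B.
Proof.
move=> [mf f0 muE] fS mB; rewrite muE// -integral_cst//.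
apply: ge0_le_integral => //.
- by move=> x _; rewrite lee_fin.
- exact/measurable_EFinP/measurable_funTS.
- by move=> x _; rewrite lee_fin.
Qed.

(** Outside its support the function vanishes, so a bound on the support that
is at least 1 is a bound everywhere. Asking for 1 <= S makes S positive and
1 / S at most 1. *)
Lemma bounded_fun_of_ereal_sup_support {T : Type} {R : realType} (D : set T)
    (f : T -> R) :
  D !=set0 -> [set x | f x != 0%R] = D ->
  ereal_sup [set (f x)%:E | x in D] < +oo ->
  exists S : R, (1 <= S)%R /\ forall x, (f x <= S)%R.
Proof.
move=> [x0 Dx0] suppf.
have le_sup x : D x -> (f x)%:E <= ereal_sup [set (f x)%:E | x in D].
  by move=> Dx; apply: ereal_sup_ubound; exists x.
case: ereal_sup le_sup => [s|//|] le_sup _; last by have := le_sup _ Dx0.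
exists (Num.max 1 s)%R; split=> [|x]; first by rewrite le_max lexx.
have [->|fx0] := eqVneq (f x) 0%R; first by rewrite le_max ler01.
have := le_sup x; rewrite -suppf lee_fin => /(_ fx0) fxs.
by rewrite le_max fxs orbT.
Qed.

(** * Comparison of exponential rates *)

Lemma bernoulli_ineq {R : realDomainType} (e : R) (n : nat) :
  (0 <= e -> 1 + e *+ n <= (1 + e) ^+ n)%R.
Proof.
move=> e0; elim: n => [|n IH]; first by rewrite mulr0n addr0 expr0.
rewrite exprS; apply: (@le_trans _ _ ((1 + e) * (1 + e *+ n))%R).
  have : (0 <= e * (e *+ n))%R by rewrite mulr_ge0// mulrn_wge0.
  by rewrite mulrS; lra.
by rewrite ler_wpM2l// addr_ge0.
Qed.

(** If w exceeded rho, the powers of w / rho would grow at least linearly by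
Bernoulli's inequality, whereas they are bounded by M / C. *)
Lemma le_base_of_geometric_le {R : archiRealFieldType} (C M w rho : R) :
  (0 < C)%R -> (0 < rho)%R ->
  (forall t : nat, (0 < t)%N -> (C * w ^+ t <= M * rho ^+ t)%R) -> (w <= rho)%R.
Proof.
move=> C0 r0 le_t; rewrite leNgt; apply/negP => rw.
pose e := (w / rho - 1)%R.
have e0 : (0 < e)%R by rewrite subr_gt0 ltr_pdivlMr// mul1r.
have M_ge t : (0 < t)%N -> (e *+ t <= M / C)%R.
  move=> t0; rewrite ler_pdivlMr// mulrC.
  have : (C * (1 + e *+ t) <= C * (w / rho) ^+ t)%R.
    rewrite (_ : w / rho = 1 + e)%R; last by rewrite addrC subrK.
    by rewrite ler_wpM2l ?bernoulli_ineq ?ltW.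
  rewrite expr_div_n mulrA => le1.
  have : (C * w ^+ t / rho ^+ t <= M)%R.
    by rewrite ler_pdivrMr ?exprn_gt0// le_t.
  move: le1; lra.
have := archi_boundP (_ : 0 <= `|M / C / e|)%R.
set k := Num.bound _ => /(_ (normr_ge0 _)) hk.
have kM : (M / C / e < k.+1%:R)%R.
  rewrite (le_lt_trans (ler_norm _))// (lt_trans hk)//.
  by rewrite ltr_nat.
by move: kM; rewrite ltr_pdivrMr// mulr_natl ltNge M_ge.
Qed.

(** Since r^(1/d) * r = r^((d+1)/d), this is monotonicity of the power
d/(d+1). *)
Lemma le_powR_of_root_mul_le {R : realType} (r rho : R) (d : nat) :
  (0 < d)%N -> (0 <= r)%R -> (0 <= rho)%R -> (r `^ d%:R^-1 * r <= rho)%R ->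
  (r <= rho `^ (d%:R / d.+1%:R))%R.
Proof.
move=> d0 r0 rho0 le_rho.
have dR0 : d%:R != 0%R :> R by rewrite pnatr_eq0 -lt0n.
have -> : r = ((r `^ d%:R^-1 * r) `^ (d%:R / d.+1%:R))%R.
  rewrite -{3}(powRr1 r0) -powRD; last first.
    by rewrite gt_eqF// addr_gt0// invr_gt0 ltr0n.
  rewrite -powRrM -{1}(powRr1 r0); congr powR.
  by rewrite -natr1; field; rewrite natr1 pnatr_eq0 dR0.
by rewrite ge0_ler_powR ?nnegrE ?divr_ge0// mulr_ge0// powR_ge0.
Qed.

(** * The bound on the convergence rate *)

Theorem theorem4 (R : realType) (d : nat) (d_gt0 : (0 < d)%N)
    (Theta : set (d.-tuple R))
    (mTheta : measurable Theta) (Theta_neq0 : Theta !=set0)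
    (Pi : probability (d.-tuple R) R) (fPi : d.-tuple R -> R)
    (Pi_Theta : Pi Theta = 1)
    (Pi_density : has_density (lebesgue_tuple d) Pi fPi)
    (supp_Pi : [set x | fPi x != 0%R] = Theta)
    (sup_fPi : ereal_sup [set (fPi x)%:E | x in Theta] < +oo)
    (c : d.-tuple R -> d.-tuple R -> R)
    (c_metric : metric_cost c)
    (mc : measurable_fun setT
            (fun z : (d.-tuple R * d.-tuple R)%type => c z.1 z.2))
    (C0 : R) (C0_gt0 : (0 < C0)%R)
    (c_ge : forall x y, (C0 * dist1 x y <= c x y)%R)
    (Q : d.-tuple R -> probability (d.-tuple R) R)
    (q a : d.-tuple R -> d.-tuple R -> R)
    (P : R.-pker d.-tuple R ~> d.-tuple R)
    (P_arb : arb_kernel (lebesgue_tuple d) Q q a P)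
    (P_inv : invariant_measure P Pi)
    (p : nat) (p_gt0 : (0 < p)%N)
    (rho : R) (M : d.-tuple R -> R)
    (P_ergodic : geometrically_ergodic c p rho M Theta P Pi) :
  1 - ereal_inf [set acceptance_prob (lebesgue_tuple d) q a x | x in Theta]
    <= (rho `^ (d%:R / d.+1%:R))%:E.
Proof.
have [rho01 _ Werg] := P_ergodic; have /andP[rho0 rho1] := rho01.
have [c0 _ _ _] := c_metric.
have [S [S1 fS]] := bounded_fun_of_ereal_sup_support _ _ Theta_neq0 supp_Pi sup_fPi.
set B := (rho `^ _)%:E.
suff rej_le x : Theta x -> 1 - acceptance_prob (lebesgue_tuple d) q a x <= B.
  have infB : 1 - B <= ereal_inf
      [set acceptance_prob (lebesgue_tuple d) q a x | x in Theta].
    apply: le_ereal_inf_tmp => _ [x Tx <-].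
    have := rej_le x Tx; rewrite leeBlDr; last first.
      have /andP[A0 A1] := acceptance_prob_ge0_le1 _ _ _ _ _ x P_arb.
      by rewrite ge0_fin_numE// (le_lt_trans A1)// ltry.
    by rewrite leeBlDl// addeC.
  apply: (le_trans (leeB (lexx 1) infB)).
  by rewrite /B -!EFinB subKr.
move=> Tx; have mx := measurable_tuple_set1 x.
have /andP[A0 A1] := acceptance_prob_ge0_le1 _ _ _ _ _ x P_arb.
have := arb_kernel_atom_ge _ _ _ _ _ x P_arb mx.
have Afin : acceptance_prob (lebesgue_tuple d) q a x \is a fin_num.
  by rewrite ge0_fin_numE// (le_lt_trans A1)// ltry.
move: A0 A1; rewrite -(fineK Afin) -EFinB !lee_fin.
set A := fine _; rewrite -[_%:E]/((1 - A)%R%:E); set r := (1 - A)%R => A0 A1 rP.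
have r0 : (0 <= r)%R by rewrite subr_ge0.
have r1 : (r <= 1)%R by rewrite gerBl.
apply: le_powR_of_root_mul_le => //; first exact: ltW.
have [->|r_neq0] := eqVneq r 0%R; first by rewrite mulr0 ltW.
(* From here on r > 0, so that the cube below has a positive side. *)
have {r_neq0} r_gt0 : (0 < r)%R by rewrite lt_neqAle eq_sym r_neq0.
set s := (r `^ _)%R.
have s0 : (0 < s)%R by exact: powR_gt0.
have sd : (s ^+ d = r)%R.
  by rewrite -powR_mulrn ?powR_ge0// -powRrM mulVf ?powRr1// pnatr_eq0 -lt0n.
(* The cube at time t has half-side K * s ^+ t.  With this K, the quantity
   2 * K <= 1 bounds its d-th power from above, and S * (2 * K) = 1 / 2, so the
   target mass of the cube is at most r ^+ t / 2. *)
pose K := ((4 * S)^-1)%R.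
have S0 : (0 < S)%R by exact: lt_le_trans S1.
have K0 : (0 < K)%R by rewrite invr_gt0 mulr_gt0.
have SK : (S * (2 * K) ^+ d <= 2^-1)%R.
  have SKE : (S * (2 * K) = 2^-1)%R.
    by rewrite /K; field; rewrite gt_eqF.
  rewrite -SKE ler_pM2l// -(prednK d_gt0) exprS ler_piMr ?mulr_ge0 ?(ltW K0)//.
  rewrite exprn_ile1 ?mulr_ge0 ?(ltW K0)//.
  have : (S * (2 * K) <= S * 1)%R by rewrite SKE; lra.
  by rewrite ler_pM2l.
apply: (le_base_of_geometric_le (C0 * K / 2) (M x)) => //.
  by rewrite divr_gt0// mulr_gt0.
move=> t t0; rewrite -lee_fin; apply: le_trans (Werg x Tx t t0).
have rt1 : (r ^+ t <= 1)%R by rewrite exprn_ile1.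
have rt0 : (0 <= r ^+ t)%R by rewrite exprn_ge0.
have h0 : (0 < K * s ^+ t)%R by rewrite mulr_gt0// exprn_gt0.
rewrite (_ : (C0 * K / 2 * (s * r) ^+ t = C0 * (K * s ^+ t) * (r ^+ t / 2))%R);
  last by rewrite exprMn; field.
apply: (wasserstein_ge _ _ _ _ [set x] (cube x (K * s ^+ t))) => //.
- exact: measurable_cube.
- by rewrite mulr_ge0// ltW.
- by apply/andP; split; lra.
- apply: le_trans (kernel_pow_atom_ge _ _ _ t mx r0 rP).
  apply: (@le_trans _ _ ((r ^+ t / 2)%:E + S%:E * lebesgue_tuple d (cube x (K * s ^+ t)))).
    rewrite leeD2l//; apply: has_density_le Pi_density fS _.
    exact: measurable_cube.
  rewrite lebesgue_tuple_cube// -EFinM -EFinD lee_fin.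
  rewrite mulrA exprMn -exprM mulnC exprM sd.
  have : (S * (2 * K) ^+ d * r ^+ t <= 2^-1 * r ^+ t)%R by rewrite ler_wpM2r.
  by rewrite -mulrA; lra.
- move=> _ y -> /dist1_ge_notin_cube hy; apply: le_trans (c_ge x y).
  by rewrite ler_pM2l.
Qed.
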